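(* Let $u''=w(x,u,u')$ be a second-order r-CODE (a scalar second-order ODE for a complex-valued function $u$ of a real variable $x$), and write $u(x)=f(x)+ig(x)$ with $f,g$ real-valued, so that the r-CODE corresponds to the system of two real second-order ODEs $$f''=w_1(x,f,g,f',g'),\qquad g''=w_2(x,f,g,f',g'),\qquad w=w_1+iw_2 .$$ If $L(x,u,u')=L_1+iL_2$ (with $L_1,L_2$ real-valued) is a complex Lagrangian of the r-CODE, then both $L_1(x,f,g,f',g')$ and $L_2(x,f,g,f',g')$ are Lagrangians of the corresponding system of two second-order ODEs; that is, for each $k\in\{1,2\}$ the system is the system of Euler-Lagrange equations $$\frac{\partial L_k}{\partial f}-\frac{d}{dx}\left(\frac{\partial L_k}{\partial f'}\right)=0,\qquad \frac{\partial L_k}{\partial g}-\frac{d}{dx}\left(\frac{\partial L_k}{\partial g'}\right)=0 .$$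
   Context: An r-CODE (restricted complex ordinary differential equation) is an ODE $u''=w(x,u,u')$ whose unknown $u$ is a complex-valued function of a single real variable $x$. Substituting $u=f+ig$ and separating real and imaginary parts gives the corresponding system of two real ODEs for $(f,g)$. A complex Lagrangian of the r-CODE is a complex-valued function $L(x,u,u')$, smooth in the real variable $x$ and complex analytic in $u$ and $u'$, whose complex Euler-Lagrange equation $$\frac{\partial L}{\partial u}-\frac{d}{dx}\left(\frac{\partial L}{\partial u'}\right)=0$$ is equivalent to the r-CODE. Here $\partial/\partial u$, $\partial/\partial u'$ are complex derivatives. With $u=f+ig$, $u'=f'+ig'$, the real and imaginary parts of $L$ are regarded as real functions $L_1,L_2$ of $(x,f,g,f',g')$. A real function $\Lambda(x,f,g,f',g')$ is a Lagrangian of a system of two second-order ODEs for $(f,g)$ if its usual Euler-Lagrange equations with respect to $f$ and $g$ are equivalent to the system. *)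

(* Defs.v *)
(* Stdlib reals with Coquelicot: complex numbers are pairs of reals, so the
   pair (f, g) : C is f + i g. *)
From Stdlib Require Import Reals.
From Coquelicot Require Import Coquelicot.
Open Scope R_scope.

(* Throughout, a function of (x, u, u') or (x, f, g, f', g') is a total function
   of which only the values on a jet domain Omega matter, so that right-hand
   sides and Lagrangians may have singularities. *)

Definition open_jet_domain (Omega : R -> C -> C -> Prop) : Prop :=
  open (fun p : R * (C * C) => Omega (fst p) (fst (snd p)) (snd (snd p))).

Definition open_interval (a b : Rbar) (x : R) : Prop :=
  Rbar_lt a x /\ Rbar_lt x b.

(** * Complex-valued unknowns of a real variable *)

Definition is_Rderive (u : R -> C) (x : R) (l : C) : Prop :=
  @is_derive R_AbsRing C_R_NormedModule u x l.

(* u1 and u2 are the first and second derivatives of u. *)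
Definition complex_curve (Omega : R -> C -> C -> Prop) (I : R -> Prop)
    (u u1 u2 : R -> C) : Prop :=
  forall x, I x ->
    is_Rderive u x (u1 x) /\ is_Rderive u1 x (u2 x) /\ Omega x (u x) (u1 x).

Definition solves_rCODE (w : R -> C -> C -> C) (I : R -> Prop)
    (u u1 u2 : R -> C) : Prop :=
  forall x, I x -> u2 x = w x (u x) (u1 x).

Definition dL_du (L : R -> C -> C -> C) (x : R) (u v : C) : C :=
  C_derive (fun z => L x z v) u.

Definition dL_du' (L : R -> C -> C -> C) (x : R) (u v : C) : C :=
  C_derive (fun z => L x u z) v.

(* The existence of the total derivative d/dx is part of the equation. *)
Definition solves_complex_EL (L : R -> C -> C -> C) (I : R -> Prop)
    (u u1 : R -> C) : Prop :=
  forall x, I x ->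
    exists D : C,
      is_Rderive (fun t => dL_du' L t (u t) (u1 t)) x D /\
      (dL_du L x (u x) (u1 x) - D)%C = RtoC 0.

Definition smooth_in_x (Omega : R -> C -> C -> Prop) (L : R -> C -> C -> C)
    : Prop :=
  forall x u v, Omega x u v -> forall n : nat,
    ex_derive_n (fun t => Re (L t u v)) n x /\
    ex_derive_n (fun t => Im (L t u v)) n x.

(* Near every point, L x is the sum of an absolutely convergent double power
   series; the terms are grouped by total degree. *)
Definition analytic_in_u_u' (Omega : R -> C -> C -> Prop) (L : R -> C -> C -> C)
    : Prop :=
  forall x u v, Omega x u v ->
    exists (r : R) (a : nat -> nat -> C), 0 < r /\
      forall h k : C, Cmod h < r -> Cmod k < r ->
        ex_series (fun n : nat =>
          sum_n (fun j => Cmod (a j (n - j)%nat * h ^ j * k ^ (n - j))%C) n) /\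
        is_series (fun n : nat =>
          sum_n (fun j => (a j (n - j)%nat * h ^ j * k ^ (n - j))%C) n)
          (L x (u + h)%C (v + k)%C).

Definition is_complex_Lagrangian (Omega : R -> C -> C -> Prop)
    (w L : R -> C -> C -> C) : Prop :=
  smooth_in_x Omega L /\
  analytic_in_u_u' Omega L /\
  forall (a b : Rbar) (u u1 u2 : R -> C),
    complex_curve Omega (open_interval a b) u u1 u2 ->
    (solves_complex_EL L (open_interval a b) u u1 <->
     solves_rCODE w (open_interval a b) u u1 u2).

(** * Pairs of real unknowns *)

Definition real_curve (Omega : R -> R -> R -> R -> R -> Prop) (I : R -> Prop)
    (f f1 f2 g g1 g2 : R -> R) : Prop :=
  forall x, I x ->
    is_derive f x (f1 x) /\ is_derive f1 x (f2 x) /\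
    is_derive g x (g1 x) /\ is_derive g1 x (g2 x) /\
    Omega x (f x) (g x) (f1 x) (g1 x).

Definition solves_system (w1 w2 : R -> R -> R -> R -> R -> R) (I : R -> Prop)
    (f f1 f2 g g1 g2 : R -> R) : Prop :=
  forall x, I x ->
    f2 x = w1 x (f x) (g x) (f1 x) (g1 x) /\
    g2 x = w2 x (f x) (g x) (f1 x) (g1 x).

Definition dLam_df (Lam : R -> R -> R -> R -> R -> R) (x f g p q : R) : R :=
  Derive (fun s => Lam x s g p q) f.
Definition dLam_dg (Lam : R -> R -> R -> R -> R -> R) (x f g p q : R) : R :=
  Derive (fun s => Lam x f s p q) g.
Definition dLam_df' (Lam : R -> R -> R -> R -> R -> R) (x f g p q : R) : R :=
  Derive (fun s => Lam x f g s q) p.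
Definition dLam_dg' (Lam : R -> R -> R -> R -> R -> R) (x f g p q : R) : R :=
  Derive (fun s => Lam x f g p s) q.

Definition has_partials (Omega : R -> R -> R -> R -> R -> Prop)
    (Lam : R -> R -> R -> R -> R -> R) : Prop :=
  forall x f g p q, Omega x f g p q ->
    ex_derive (fun s => Lam x s g p q) f /\
    ex_derive (fun s => Lam x f s p q) g /\
    ex_derive (fun s => Lam x f g s q) p /\
    ex_derive (fun s => Lam x f g p s) q.

Definition solves_real_EL (Lam : R -> R -> R -> R -> R -> R) (I : R -> Prop)
    (f f1 g g1 : R -> R) : Prop :=
  forall x, I x ->
    (exists D : R,
      is_derive (fun t => dLam_df' Lam t (f t) (g t) (f1 t) (g1 t)) x D /\
      dLam_df Lam x (f x) (g x) (f1 x) (g1 x) - D = 0) /\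
    (exists D : R,
      is_derive (fun t => dLam_dg' Lam t (f t) (g t) (f1 t) (g1 t)) x D /\
      dLam_dg Lam x (f x) (g x) (f1 x) (g1 x) - D = 0).

Definition is_real_Lagrangian (Omega : R -> R -> R -> R -> R -> Prop)
    (w1 w2 Lam : R -> R -> R -> R -> R -> R) : Prop :=
  has_partials Omega Lam /\
  forall (a b : Rbar) (f f1 f2 g g1 g2 : R -> R),
    real_curve Omega (open_interval a b) f f1 f2 g g1 g2 ->
    (solves_real_EL Lam (open_interval a b) f f1 g g1 <->
     solves_system w1 w2 (open_interval a b) f f1 f2 g g1 g2).

(** * Passing from (u, u') to (f, g, f', g') *)

Definition real_domain (Omega : R -> C -> C -> Prop) (x f g p q : R) : Prop :=
  Omega x (f, g) (p, q).
Definition re_part (F : R -> C -> C -> C) (x f g p q : R) : R :=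
  Re (F x (f, g) (p, q)).
Definition im_part (F : R -> C -> C -> C) (x f g p q : R) : R :=
  Im (F x (f, g) (p, q)).

(* Main.v *)
Require Import Defs.
From Stdlib Require Import Reals.
From Coquelicot Require Import Coquelicot.
From Stdlib Require Import Lra Lia.
Open Scope R_scope.

(** Why the theorem holds.  At a point of the jet domain the two partial
    functions [z => L x z v] and [z => L x u z] are sums of power series, hence
    complex differentiable ([analytic_is_derive]).  By the Cauchy-Riemann
    equations ([is_derive_partials]) a single complex derivative [l] carries
    all the real partial derivatives: for [z = s + i t],
      d(Re F)/ds = Re l,   d(Re F)/dt = - Im l,
      d(Im F)/ds = Im l,   d(Im F)/dt = Re l.
    Differentiation along a real variable acts separately on real and imaginary
    parts ([is_Rderive_components]).  So, with E the left-hand side of the complex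
    Euler-Lagrange equation, the two real equations of [L_1 = Re L] are Re E = 0
    and - Im E = 0, and those of [L_2 = Im L] are Im E = 0 and Re E = 0.  Each
    pair is equivalent to E = 0 ([real_EL_re_part], [real_EL_im_part]), which by
    assumption is equivalent to the r-CODE, that is, to the real system. *)

(** * Complex derivatives of power series *)

Lemma is_derive_C_remainder (F : C -> C) (z l : C) :
  is_derive F z l <->
  forall eps : posreal, exists d : posreal, forall h : C, Cmod h < d ->
    Cmod (F (z + h) - F z - h * l)%C <= eps * Cmod h.
Proof.
split.
- intros [_ HF] eps.
  destruct (HF z (fun P HP => HP) eps) as [d Hd].
  exists d; intros h Hh.
  assert (E : (z + h - z)%C = h) by ring.
  specialize (Hd (z + h)%C).
  change (Cmod (z + h - z)%C < d ->
    Cmod (F (z + h)%C - F z - (z + h - z) * l)%C <= eps * Cmod (z + h - z)%C) in Hd.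
  rewrite E in Hd; exact (Hd Hh).
- intros H; split; [apply is_linear_scal_l|].
  assert (E : forall y : C, (z + (y - z))%C = y) by (intros; ring).
  intros y Hy eps.
  apply (is_filter_lim_locally_unique (V := AbsRing_NormedModule C_AbsRing) z y) in Hy; subst y.
  destruct (H eps) as [d Hd].
  exists d; intros y Hy.
  change (Cmod (y - z)%C < d) in Hy.
  change (Cmod (F y - F z - (y - z) * l)%C <= eps * Cmod (y - z)%C).
  specialize (Hd _ Hy).
  rewrite E in Hd; exact Hd.
Qed.

(** Beyond its linear part a power series is at most quadratic in [h]: for
    [|h| <= rho] and [n >= 2], [|h|^n <= (|h| / rho)^2 * rho^n]. *)
Lemma power_series_partial_sum_bound (c : nat -> C) (rho : R) (h : C) (N : nat) :
  0 < rho -> Cmod h <= rho ->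
  Cmod (sum_n (fun n => c n * h ^ n) (S N) - c O - h * c 1%nat)%C
  <= (Cmod h / rho) ^ 2 * sum_n (fun n => Cmod (c n * RtoC rho ^ n)%C) (S N).
Proof.
intros Hrho Hh.
assert (Hq : 0 <= Cmod h / rho <= 1).
{ pose proof (Cmod_ge_0 h). split.
  - apply Rdiv_le_0_compat; lra.
  - apply (Rmult_le_reg_r rho); [lra|]. field_simplify; lra. }
assert (Hq2 : 0 <= (Cmod h / rho) ^ 2) by apply pow2_ge_0.
assert (Hterm : forall n, Cmod (c (S (S n)) * h ^ S (S n))%C
    <= (Cmod h / rho) ^ 2 * Cmod (c (S (S n)) * RtoC rho ^ S (S n))%C).
{ intros n. rewrite !Cmod_mult, !Cmod_pow, Cmod_R, (Rabs_pos_eq rho) by lra.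
  rewrite (Rmult_comm ((Cmod h / rho) ^ 2)), Rmult_assoc.
  apply Rmult_le_compat_l; [apply Cmod_ge_0|].
  replace (Cmod h ^ S (S n)) with ((Cmod h / rho) ^ 2 * (rho ^ 2 * Cmod h ^ n))
    by (simpl; field; lra).
  rewrite (Rmult_comm (rho ^ S (S n))).
  apply Rmult_le_compat_l; [exact Hq2|].
  replace (rho ^ S (S n)) with (rho ^ 2 * rho ^ n) by (simpl; ring).
  apply Rmult_le_compat_l; [apply pow2_ge_0|].
  apply pow_incr; split; [apply Cmod_ge_0 | exact Hh]. }
induction N as [|N IH].
- rewrite !sum_Sn, !sum_O.
  change (Cmod (c O * h ^ 0 + c 1%nat * h ^ 1 - c O - h * c 1%nat)%C <=
    (Cmod h / rho) ^ 2 * (Cmod (c O * RtoC rho ^ 0) + Cmod (c 1%nat * RtoC rho ^ 1))).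
  replace (c O * h ^ 0 + c 1%nat * h ^ 1 - c O - h * c 1%nat)%C with (RtoC 0)
    by (simpl; ring).
  rewrite Cmod_0. apply Rmult_le_pos; [exact Hq2|].
  apply Rplus_le_le_0_compat; apply Cmod_ge_0.
- rewrite (sum_Sn _ (S N)), (sum_Sn (fun n => Cmod _) (S N)).
  set (A := sum_n (fun n => (c n * h ^ n)%C) (S N)) in *.
  set (B := sum_n (fun n => Cmod (c n * RtoC rho ^ n)%C) (S N)) in *.
  change (Cmod (A + c (S (S N)) * h ^ S (S N) - c O - h * c 1%nat)%C <=
    (Cmod h / rho) ^ 2 * (B + Cmod (c (S (S N)) * RtoC rho ^ S (S N))%C)).
  replace (A + c (S (S N)) * h ^ S (S N) - c O - h * c 1%nat)%C
    with ((A - c O - h * c 1%nat) + c (S (S N)) * h ^ S (S N))%C by ring.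
  eapply Rle_trans; [apply Cmod_triangle|].
  rewrite Rmult_plus_distr_l.
  apply Rplus_le_compat; [exact IH | apply Hterm].
Qed.

Lemma sum_n_le_Series (a : nat -> R) (N : nat) :
  (forall n, 0 <= a n) -> ex_series a -> sum_n a N <= Series a.
Proof.
intros Ha Hex.
apply is_lim_seq_incr_compare; [exact (Series_correct a Hex)|].
intros n; rewrite sum_Sn; unfold plus; simpl; specialize (Ha (S n)); lra.
Qed.

Lemma is_series_C_approx (a : nat -> C) (l : C) (N0 : nat) (eps : R) :
  0 < eps -> is_series a l ->
  exists N, (N0 <= N)%nat /\ Cmod (l - sum_n a N)%C < eps.
Proof.
intros Heps Ha.
destruct (proj1 (filterlim_locally_ball_norm _ _) Ha (mkposreal _ Heps)) as [N HN].
exists (max N0 N); split; [lia|].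
specialize (HN (max N0 N) ltac:(lia)).
change (Cmod (sum_n a (max N0 N) - l)%C < eps) in HN.
rewrite <- Cmod_opp.
replace (- (l - sum_n a (max N0 N)))%C with (sum_n a (max N0 N) - l)%C by ring.
exact HN.
Qed.

Lemma power_series_is_derive (F : C -> C) (z : C) (r : R) (c : nat -> C) :
  0 < r ->
  (forall h, Cmod h < r ->
     ex_series (fun n => Cmod (c n * h ^ n)%C) /\
     is_series (fun n => (c n * h ^ n)%C) (F (z + h)%C)) ->
  is_derive F z (c 1%nat).
Proof.
intros Hr HF.
set (rho := r / 2).
assert (Hrho : 0 < rho < r) by (unfold rho; lra).
set (b := fun n => Cmod (c n * RtoC rho ^ n)%C).
assert (Hb : ex_series b).
{ apply (HF (RtoC rho)). rewrite Cmod_R, Rabs_pos_eq; lra. }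
set (M := Series b).
assert (HM : 0 <= M).
{ eapply Rle_trans; [|apply (sum_n_le_Series b 0)]; trivial.
  - rewrite sum_O; apply Cmod_ge_0.
  - intros n; apply Cmod_ge_0. }
assert (Hquad : forall h, Cmod h <= rho ->
  Cmod (F (z + h) - c O - h * c 1%nat)%C <= (Cmod h / rho) ^ 2 * M).
{ intros h Hh. apply le_epsilon; intros eps Heps.
  destruct (is_series_C_approx _ _ 1 eps Heps (proj2 (HF h ltac:(lra))))
    as [[|N] [HN1 HN]]; [lia|].
  set (A := sum_n (fun n => (c n * h ^ n)%C) (S N)) in *.
  replace (F (z + h) - c O - h * c 1%nat)%C
    with ((A - c O - h * c 1%nat) + (F (z + h) - A))%C by ring.
  eapply Rle_trans; [apply Cmod_triangle|].
  apply Rplus_le_compat; [|lra].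
  eapply Rle_trans;
    [apply (power_series_partial_sum_bound c rho h N); lra|].
  apply Rmult_le_compat_l; [apply pow2_ge_0|].
  apply (sum_n_le_Series b); [intros n; apply Cmod_ge_0 | exact Hb]. }
assert (Hz : F z = c O).
{ assert (H0 := Hquad (RtoC 0)). rewrite Cmod_0 in H0.
  replace (z + RtoC 0)%C with z in H0 by ring.
  replace (F z - c O - RtoC 0 * c 1%nat)%C with (F z - c O)%C in H0 by ring.
  assert (H1 : Cmod (F z - c O)%C = 0).
  { apply Rle_antisym; [|apply Cmod_ge_0].
    eapply Rle_trans; [apply H0; lra|]. unfold Rdiv; simpl; lra. }
  apply Cmod_eq_0 in H1.
  replace (F z) with ((F z - c O) + c O)%C by ring. rewrite H1; ring. }
apply is_derive_C_remainder; intros [eps Heps]; cbn [pos].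
(* On this ball the quadratic bound M |h|^2 / rho^2 is at most eps |h|. *)
assert (Hd : 0 < Rmin rho (eps * rho ^ 2 / (M + 1))).
{ apply Rmin_pos; [lra|].
  apply Rdiv_lt_0_compat; [apply Rmult_lt_0_compat; [lra|apply pow_lt; lra] | lra]. }
exists (mkposreal _ Hd); cbn [pos]; intros h Hh.
assert (Hh1 := Rlt_le_trans _ _ _ Hh (Rmin_l _ _)).
assert (Hh2 := Rlt_le_trans _ _ _ Hh (Rmin_r _ _)).
rewrite Hz.
eapply Rle_trans; [apply Hquad; lra|].
pose proof (Cmod_ge_0 h) as Hh0.
assert (Hr2 : 0 < rho ^ 2) by (apply pow_lt; lra).
apply (Rmult_lt_compat_r (M + 1)) in Hh2; [|lra].
replace (eps * rho ^ 2 / (M + 1) * (M + 1)) with (eps * rho ^ 2) in Hh2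
  by (field; lra).
apply (Rmult_le_reg_r (rho ^ 2)); [exact Hr2|].
replace ((Cmod h / rho) ^ 2 * M * rho ^ 2) with (Cmod h * (Cmod h * M))
  by (field; lra).
replace (eps * Cmod h * rho ^ 2) with (Cmod h * (eps * rho ^ 2)) by ring.
apply Rmult_le_compat_l; lra.
Qed.

Lemma sum_n_only_last {G : AbelianMonoid} (a : nat -> G) (n : nat) :
  (forall j, (j < n)%nat -> a j = zero) -> sum_n a n = a n.
Proof.
destruct n as [|n]; intros H; [apply sum_O|].
rewrite sum_Sn, (sum_n_ext_loc a (fun _ => zero)) by (intros; apply H; lia).
unfold sum_n; rewrite sum_n_m_const_zero; apply plus_zero_l.
Qed.

Lemma sum_n_only_first {G : AbelianMonoid} (a : nat -> G) (n : nat) :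
  (forall j, (0 < j <= n)%nat -> a j = zero) -> sum_n a n = a O.
Proof.
intros H; unfold sum_n; rewrite sum_Sn_m by lia.
rewrite (sum_n_m_ext_loc a (fun _ => zero)) by (intros; apply H; lia).
rewrite sum_n_m_const_zero; apply plus_zero_r.
Qed.

Lemma Cpow_0_S (n : nat) : (RtoC 0 ^ S n)%C = RtoC 0.
Proof. simpl; ring. Qed.

(** Setting one increment of the double series to zero leaves, in each total
    degree, a single term: a one-variable power series in the other increment. *)
Lemma analytic_is_derive (Omega : R -> C -> C -> Prop) (L : R -> C -> C -> C)
    (x : R) (u v : C) :
  analytic_in_u_u' Omega L -> Omega x u v ->
  is_derive (fun z => L x z v) u (dL_du L x u v) /\
  is_derive (fun z => L x u z) v (dL_du' L x u v).
Proof.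
intros HL HO; destruct (HL x u v HO) as [r [a [Hr Ha]]].
assert (H0 : Cmod (RtoC 0) < r) by (rewrite Cmod_0; exact Hr).
assert (Hu : is_derive (fun z => L x z v) u (a 1%nat O)).
{ apply (power_series_is_derive _ u r (fun n => a n O) Hr); intros h Hh.
  destruct (Ha h (RtoC 0) Hh H0) as [H1 H2].
  replace (v + RtoC 0)%C with v in H2 by ring.
  assert (Hlast : forall n, (a n (n - n)%nat * h ^ n * RtoC 0 ^ (n - n))%C
                            = (a n O * h ^ n)%C).
  { intros n; rewrite Nat.sub_diag; simpl; ring. }
  assert (Hvan : forall n j, (j < n)%nat ->
    (a j (n - j)%nat * h ^ j * RtoC 0 ^ (n - j))%C = RtoC 0).
  { intros n j Hj; replace (n - j)%nat with (S (n - j - 1)) at 2 by lia.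
    rewrite Cpow_0_S; ring. }
  split.
  - eapply ex_series_ext; [|exact H1]; intros n; simpl.
    rewrite sum_n_only_last; [now rewrite Hlast|].
    intros j Hj; rewrite Hvan by exact Hj; apply Cmod_0.
  - eapply is_series_ext; [|exact H2]; intros n; simpl.
    rewrite sum_n_only_last; [apply Hlast|].
    intros j Hj; apply Hvan, Hj. }
assert (Hv : is_derive (fun z => L x u z) v (a O 1%nat)).
{ apply (power_series_is_derive _ v r (fun n => a O n) Hr); intros k Hk.
  destruct (Ha (RtoC 0) k H0 Hk) as [H1 H2].
  replace (u + RtoC 0)%C with u in H2 by ring.
  assert (Hfirst : forall n, (a O (n - 0)%nat * RtoC 0 ^ 0 * k ^ (n - 0))%C
                             = (a O n * k ^ n)%C).
  { intros n; rewrite Nat.sub_0_r; simpl; ring. }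
  assert (Hvan : forall n j, (0 < j <= n)%nat ->
    (a j (n - j)%nat * RtoC 0 ^ j * k ^ (n - j))%C = RtoC 0).
  { intros n [|j] Hj; [lia|]. rewrite Cpow_0_S; ring. }
  split.
  - eapply ex_series_ext; [|exact H1]; intros n; simpl.
    rewrite sum_n_only_first; [now rewrite Hfirst|].
    intros j Hj; rewrite Hvan by exact Hj; apply Cmod_0.
  - eapply is_series_ext; [|exact H2]; intros n; simpl.
    rewrite sum_n_only_first; [apply Hfirst|].
    intros j Hj; apply Hvan, Hj. }
assert (Eu : dL_du L x u v = a 1%nat O) by exact (is_C_derive_unique _ _ _ Hu).
assert (Ev : dL_du' L x u v = a O 1%nat) by exact (is_C_derive_unique _ _ _ Hv).
rewrite Eu, Ev; split; assumption.
Qed.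

(** * Derivatives in real directions *)

Lemma is_Rderive_components (u : R -> C) (x : R) (l : C) :
  is_Rderive u x l <->
  is_derive (fun t => Re (u t)) x (Re l) /\ is_derive (fun t => Im (u t)) x (Im l).
Proof.
unfold is_Rderive; split.
- intros H; split; unfold is_derive.
  + refine (filterdiff_comp' (U := AbsRing_NormedModule R_AbsRing)
      (V := C_R_NormedModule) (W := R_NormedModule)
      u (fun p => fst p) x _ (fun p => fst p) H _).
    apply filterdiff_linear, is_linear_fst.
  + refine (filterdiff_comp' (U := AbsRing_NormedModule R_AbsRing)
      (V := C_R_NormedModule) (W := R_NormedModule)
      u (fun p => snd p) x _ (fun p => snd p) H _).
    apply filterdiff_linear, is_linear_snd.
- intros [H1 H2].
  apply (is_derive_ext (V := C_R_NormedModule) (fun t => (Re (u t), Im (u t)))).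
  { intros t; now destruct (u t). }
  assert (Hpair : filterdiff
      (fun p : prod_NormedModule R_AbsRing R_NormedModule R_NormedModule =>
         (fst p, snd p) : C_R_NormedModule)
      (locally (Re (u x), Im (u x)))
      (fun p => (fst p, snd p) : C_R_NormedModule)).
  { apply filterdiff_linear.
    split; [reflexivity|reflexivity|].
    exists 1; split; [lra|]; intros p; rewrite Rmult_1_l; apply Rle_refl. }
  exact (filterdiff_comp'_2 (T := AbsRing_NormedModule R_AbsRing)
    (U := R_NormedModule) (V := R_NormedModule) (W := C_R_NormedModule)
    (fun t => Re (u t)) (fun t => Im (u t)) (fun p q => (p, q)) x _ _ _ H1 H2 Hpair).
Qed.

Lemma is_Rderive_directional (F : C -> C) (z l d : C) (gamma : R -> C) (t : R) :
  Cmod d = 1 -> (forall s, gamma s = z + RtoC (s - t) * d)%C ->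
  is_derive F z l -> is_Rderive (fun s => F (gamma s)) t (d * l)%C.
Proof.
intros Hd Hgamma HF.
assert (Ht : gamma t = z).
{ rewrite Hgamma, Rminus_diag; ring. }
split; [apply is_linear_scal_l|].
intros y Hy eps.
apply (is_filter_lim_locally_unique t y) in Hy; subst y.
destruct (proj1 (is_derive_C_remainder F z l) HF eps) as [del Hdel].
exists del; intros s Hs.
change (Rabs (s - t) < del) in Hs.
assert (Hmod : Cmod (RtoC (s - t) * d)%C = Rabs (s - t)).
{ rewrite Cmod_mult, Cmod_R, Hd; ring. }
specialize (Hdel (RtoC (s - t) * d)%C).
rewrite Hmod, <- Hgamma, <- Ht in Hdel; specialize (Hdel Hs).
change (norm (minus s t)) with (Rabs (s - t)).
eapply Rle_trans; [|exact Hdel].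
(* Up to unfolding, the product norm over the reals is the complex modulus, and
   real scaling is multiplication by a real number. *)
right.
set (W := minus _ _).
assert (HW : W = (F (gamma s) - F (gamma t) - RtoC (s - t) * d * l)%C).
{ unfold W; rewrite <- Cmult_assoc.
  set (m := (d * l)%C).
  apply injective_projections; simpl; unfold minus, plus, opp, scal; simpl;
    unfold mult; simpl; ring. }
rewrite HW.
generalize (F (gamma s) - F (gamma t) - RtoC (s - t) * d * l)%C; intros q.
unfold norm; simpl; unfold prod_norm, Cmod; f_equal.
unfold norm; simpl; unfold abs; simpl.
rewrite !Rmult_1_r, <- !Rabs_mult, !Rabs_pos_eq by nra; reflexivity.
Qed.

(** The Cauchy-Riemann equations: an increment in the imaginary direction
    multiplies the derivative by [i]. *)
Lemma is_derive_partials (F : C -> C) (f g : R) (l : C) :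
  is_derive F (f, g) l ->
  (is_derive (fun s => Re (F (s, g))) f (Re l) /\
   is_derive (fun s => Im (F (s, g))) f (Im l)) /\
  (is_derive (fun s => Re (F (f, s))) g (- Im l) /\
   is_derive (fun s => Im (F (f, s))) g (Re l)).
Proof.
intros HF.
assert (H1 := is_Rderive_directional F (f, g) l (RtoC 1) (fun s => (s, g)) f).
assert (H2 := is_Rderive_directional F (f, g) l Ci (fun s => (f, s)) g).
assert (Hi : (Ci * l)%C = (- Im l, Re l)).
{ destruct l as [p q]; unfold Ci, Cmult, Re, Im; simpl; f_equal; ring. }
rewrite Cmult_1_l in H1; rewrite Hi in H2.
split.
- apply is_Rderive_components, H1; [apply Cmod_1| |exact HF].
  intros s; unfold Cmult, Cplus, RtoC; simpl; f_equal; ring.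
- apply (proj1 (is_Rderive_components _ _ (- Im l, Re l))), H2; [apply Cmod_Ci| |exact HF].
  intros s; unfold Ci, Cmult, Cplus, RtoC; simpl; f_equal; ring.
Qed.

(** * Euler-Lagrange equations of the real and imaginary parts *)

Lemma has_partials_parts (Omega : R -> C -> C -> Prop) (L : R -> C -> C -> C) :
  analytic_in_u_u' Omega L ->
  has_partials (real_domain Omega) (re_part L) /\
  has_partials (real_domain Omega) (im_part L).
Proof.
intros HL; split; intros x f g p q HO;
  destruct (analytic_is_derive Omega L x (f, g) (p, q) HL HO) as [Hu Hv];
  apply is_derive_partials in Hu; apply is_derive_partials in Hv;
  destruct Hu as [[Hu1 Hu2] [Hu3 Hu4]]; destruct Hv as [[Hv1 Hv2] [Hv3 Hv4]];
  repeat split; eexists; eassumption.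
Qed.

Lemma partials_re_part (Omega : R -> C -> C -> Prop) (L : R -> C -> C -> C)
    (x f g p q : R) :
  analytic_in_u_u' Omega L ->
  real_domain Omega x f g p q ->
  dLam_df (re_part L) x f g p q = Re (dL_du L x (f, g) (p, q)) /\
  dLam_dg (re_part L) x f g p q = - Im (dL_du L x (f, g) (p, q)) /\
  dLam_df' (re_part L) x f g p q = Re (dL_du' L x (f, g) (p, q)) /\
  dLam_dg' (re_part L) x f g p q = - Im (dL_du' L x (f, g) (p, q)).
Proof.
intros HL HO; destruct (analytic_is_derive Omega L x (f, g) (p, q) HL HO) as [Hu Hv].
apply is_derive_partials in Hu; apply is_derive_partials in Hv.
repeat split; apply is_derive_unique; tauto.
Qed.

Lemma partials_im_part (Omega : R -> C -> C -> Prop) (L : R -> C -> C -> C)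
    (x f g p q : R) :
  analytic_in_u_u' Omega L ->
  real_domain Omega x f g p q ->
  dLam_df (im_part L) x f g p q = Im (dL_du L x (f, g) (p, q)) /\
  dLam_dg (im_part L) x f g p q = Re (dL_du L x (f, g) (p, q)) /\
  dLam_df' (im_part L) x f g p q = Im (dL_du' L x (f, g) (p, q)) /\
  dLam_dg' (im_part L) x f g p q = Re (dL_du' L x (f, g) (p, q)).
Proof.
intros HL HO; destruct (analytic_is_derive Omega L x (f, g) (p, q) HL HO) as [Hu Hv].
apply is_derive_partials in Hu; apply is_derive_partials in Hv.
repeat split; apply is_derive_unique; tauto.
Qed.

Lemma open_interval_locally (a b : Rbar) (x : R) :
  Defs.open_interval a b x -> locally x (Defs.open_interval a b).
Proof.
intros Hx; apply open_and; trivial.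
- destruct a; [apply open_gt | intros y [] | intros y _; apply filter_forall].
  now intros.
- destruct b; [apply open_lt | intros y _; apply filter_forall | intros y []].
  now intros.
Qed.

Lemma is_derive_iff_locally (phi psi : R -> R) (x l : R) :
  locally x (fun t => phi t = psi t) -> is_derive phi x l <-> is_derive psi x l.
Proof.
intros H; split; apply is_derive_ext_loc; [exact H|].
revert H; apply filter_imp; intros t Ht; now symmetry.
Qed.

Lemma complex_EL_components (L : R -> C -> C -> C) (I : R -> Prop) (u u1 : R -> C) :
  solves_complex_EL L I u u1 <->
  forall x, I x ->
    is_derive (fun t => Re (dL_du' L t (u t) (u1 t))) x (Re (dL_du L x (u x) (u1 x))) /\
    is_derive (fun t => Im (dL_du' L t (u t) (u1 t))) x (Im (dL_du L x (u x) (u1 x))).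
Proof.
split; intros H x Hx; specialize (H x Hx).
- destruct H as [D [HD HE]].
  apply is_Rderive_components.
  replace (dL_du L x (u x) (u1 x)) with D; [exact HD|].
  replace D with (RtoC 0 + D)%C by ring. rewrite <- HE; ring.
- exists (dL_du L x (u x) (u1 x)); split; [|ring].
  apply is_Rderive_components, H.
Qed.

Lemma real_EL_components (Lam : R -> R -> R -> R -> R -> R) (I : R -> Prop)
    (f f1 g g1 : R -> R) :
  solves_real_EL Lam I f f1 g g1 <->
  forall x, I x ->
    is_derive (fun t => dLam_df' Lam t (f t) (g t) (f1 t) (g1 t)) x
      (dLam_df Lam x (f x) (g x) (f1 x) (g1 x)) /\
    is_derive (fun t => dLam_dg' Lam t (f t) (g t) (f1 t) (g1 t)) x
      (dLam_dg Lam x (f x) (g x) (f1 x) (g1 x)).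
Proof.
split; intros H x Hx; destruct (H x Hx) as [H1 H2].
- destruct H1 as [D1 [HD1 HE1]]; destruct H2 as [D2 [HD2 HE2]].
  apply Rminus_diag_uniq in HE1; apply Rminus_diag_uniq in HE2.
  rewrite HE1, HE2; split; assumption.
- split; eexists; (split; [eassumption | ring]).
Qed.

Lemma is_derive_opp_iff (phi : R -> R) (x l : R) :
  is_derive (fun t => - phi t) x (- l) <-> is_derive phi x l.
Proof.
split; intros H.
- rewrite <- (Ropp_involutive l).
  apply (is_derive_ext (fun t => - - phi t)); [intros t; apply Ropp_involutive|].
  exact (is_derive_opp (fun t => - phi t) x (- l) H).
- exact (is_derive_opp phi x l H).
Qed.

Lemma forall_iff_compat {A : Type} (P Q : A -> Prop) :
  (forall x, P x <-> Q x) -> (forall x, P x) <-> (forall x, Q x).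
Proof. intros H; split; intros HP x; apply H, HP. Qed.

Lemma and_iff_compat (P P' Q Q' : Prop) :
  (P <-> P') -> (Q <-> Q') -> (P /\ Q <-> P' /\ Q').
Proof. tauto. Qed.

(** The equations of both parts contain derivatives along the curve, so the
    formulas for the partial derivatives are needed on a neighbourhood of [x];
    the openness of the interval provides it. *)
Lemma real_EL_re_part (Omega : R -> C -> C -> Prop) (L : R -> C -> C -> C)
    (a b : Rbar) (f f1 g g1 : R -> R) :
  analytic_in_u_u' Omega L ->
  (forall x, Defs.open_interval a b x ->
     real_domain Omega x (f x) (g x) (f1 x) (g1 x)) ->
  solves_real_EL (re_part L) (Defs.open_interval a b) f f1 g g1 <->
  solves_complex_EL L (Defs.open_interval a b)
    (fun t => (f t, g t)) (fun t => (f1 t, g1 t)).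
Proof.
intros HL HO; rewrite real_EL_components, complex_EL_components.
apply forall_iff_compat; intros x; apply forall_iff_compat; intros Hx.
destruct (partials_re_part _ _ _ _ _ _ _ HL (HO x Hx)) as [-> [-> _]].
rewrite <- (is_derive_opp_iff (fun t => Im _)).
apply and_iff_compat; apply is_derive_iff_locally;
  generalize (open_interval_locally _ _ _ Hx); apply filter_imp; intros t Ht;
  apply (partials_re_part _ _ _ _ _ _ _ HL (HO t Ht)).
Qed.

Lemma real_EL_im_part (Omega : R -> C -> C -> Prop) (L : R -> C -> C -> C)
    (a b : Rbar) (f f1 g g1 : R -> R) :
  analytic_in_u_u' Omega L ->
  (forall x, Defs.open_interval a b x ->
     real_domain Omega x (f x) (g x) (f1 x) (g1 x)) ->
  solves_real_EL (im_part L) (Defs.open_interval a b) f f1 g g1 <->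
  solves_complex_EL L (Defs.open_interval a b)
    (fun t => (f t, g t)) (fun t => (f1 t, g1 t)).
Proof.
intros HL HO; rewrite real_EL_components, complex_EL_components.
apply forall_iff_compat; intros x; apply forall_iff_compat; intros Hx.
destruct (partials_im_part _ _ _ _ _ _ _ HL (HO x Hx)) as [-> [-> _]].
rewrite (and_comm (is_derive (fun t => Re _) _ _)).
apply and_iff_compat; apply is_derive_iff_locally;
  generalize (open_interval_locally _ _ _ Hx); apply filter_imp; intros t Ht;
  apply (partials_im_part _ _ _ _ _ _ _ HL (HO t Ht)).
Qed.

(** * The real Lagrangians *)

Lemma real_curve_complex_curve (Omega : R -> C -> C -> Prop) (I : R -> Prop)
    (f f1 f2 g g1 g2 : R -> R) :
  real_curve (real_domain Omega) I f f1 f2 g g1 g2 ->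
  complex_curve Omega I
    (fun t => (f t, g t)) (fun t => (f1 t, g1 t)) (fun t => (f2 t, g2 t)).
Proof.
intros H x Hx; destruct (H x Hx) as [Hf [Hf1 [Hg [Hg1 HO]]]].
split; [|split; [|exact HO]]; apply is_Rderive_components; split; assumption.
Qed.

Lemma solves_rCODE_system (w : R -> C -> C -> C) (I : R -> Prop)
    (f f1 f2 g g1 g2 : R -> R) :
  solves_rCODE w I
    (fun t => (f t, g t)) (fun t => (f1 t, g1 t)) (fun t => (f2 t, g2 t)) <->
  solves_system (re_part w) (im_part w) I f f1 f2 g g1 g2.
Proof.
apply forall_iff_compat; intros x; apply forall_iff_compat; intros _.
unfold re_part, im_part; split.
- intros <-; split; reflexivity.
- intros [-> ->]; now destruct (w x (f x, g x) (f1 x, g1 x)).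
Qed.

Theorem mainTheorem1 :
  forall (Omega : R -> C -> C -> Prop) (w L : R -> C -> C -> C),
    open_jet_domain Omega ->
    is_complex_Lagrangian Omega w L ->
    is_real_Lagrangian (real_domain Omega)
      (re_part w) (im_part w) (re_part L) /\
    is_real_Lagrangian (real_domain Omega)
      (re_part w) (im_part w) (im_part L).
Proof.
intros Omega w L _ [_ [HL HEL]].
destruct (has_partials_parts Omega L HL) as [Hre Him].
split; (split; [assumption|]); intros a b f f1 f2 g g1 g2 Hc;
  rewrite <- solves_rCODE_system,
    <- (HEL a b _ _ _ (real_curve_complex_curve _ _ _ _ _ _ _ _ Hc));
  [apply (real_EL_re_part Omega) | apply (real_EL_im_part Omega)];
  trivial; intros x Hx; apply (Hc x Hx).
Qed.
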